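(* Let $\mathfrak{A}$ be a unital $C^*$-algebra and $a\in\mathfrak{A}$. Then $$\max\{w_{\mathfrak{A}}(\Re(a)+i|a|^2),\,w_{\mathfrak{A}}(\Im(a)+i|a|^2)\}\leq dw_{\mathfrak{A}}(a)$$ and $$dw_{\mathfrak{A}}(a)\leq\min\left\{\sqrt{w_{\mathfrak{A}}^2(\Re(a)+i|a|^2)+\|\Im(a)\|^2},\ \sqrt{w_{\mathfrak{A}}^2(\Im(a)+i|a|^2)+\|\Re(a)\|^2}\right\}.$$
   Context: $\mathfrak{A}$ is a complex, nonzero, unital $C^*$-algebra with unit $\boldsymbol{1}$; its state space $\mathfrak{S}(\mathfrak{A})$ is the set of all positive linear functionals $f\in\mathfrak{A}^*$ with $\|f\|=f(\boldsymbol{1})=1$. For $a\in\mathfrak{A}$: $|a|=(a^*a)^{1/2}$, $\Re(a)=\frac{a+a^*}{2}$, $\Im(a)=\frac{a-a^*}{2i}$; the algebraic numerical radius is $w_{\mathfrak{A}}(a)=\sup\{|f(a)|:f\in\mathfrak{S}(\mathfrak{A})\}$; the algebraic Davis--Wielandt radius is $dw_{\mathfrak{A}}(a)=\sup\{\sqrt{|f(a)|^2+f(a^*a)^2}:f\in\mathfrak{S}(\mathfrak{A})\}$; $w_{\mathfrak{A}}^2(b)$ means $(w_{\mathfrak{A}}(b))^2$. *)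

(* Defs.v *)
From HB Require Import structures.
From mathcomp Require Import all_boot all_order all_algebra.
From mathcomp Require Import all_classical all_reals.
From mathcomp Require Export complex.

Set Implicit Arguments.
Unset Strict Implicit.
Unset Printing Implicit Defensive.

Import Order.TTheory GRing.Theory Num.Theory.

Local Open Scope classical_set_scope.
Local Open Scope ring_scope.
Local Open Scope complex_scope.

Notation normc := ComplexField.Normc.normc.

Definition cauchy_for {R : realType} {V : zmodType} (nm : V -> R)
    (u : nat -> V) :=
  forall e : R, 0 < e -> exists N : nat, forall m n : nat,
    (N <= m)%N -> (N <= n)%N -> nm (u m - u n) < e.

Definition converges_for {R : realType} {V : zmodType} (nm : V -> R)
    (u : nat -> V) (l : V) :=
  forall e : R, 0 < e -> exists N : nat, forall n : nat,
    (N <= n)%N -> nm (u n - l) < e.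

(* Unital complex C*-algebras: [GRing.Algebra] provides the unit and 1 != 0.
   The norm is a field of the mixin because the hierarchy admits no join of
   noncommutative rings with normed modules: [Num.NumDomain] already inherits
   from both, and no intermediate structure was declared before it. *)
HB.mixin Record isCStarAlgebra (R : realType) A of GRing.Algebra R[i] A := {
  star : A -> A;
  cnorm : A -> R;
  cnorm_eq0 : forall x : A, cnorm x = 0 -> x = 0;
  cnormD : forall x y : A, cnorm (x + y) <= cnorm x + cnorm y;
  cnormZ : forall (c : R[i]) (x : A), cnorm (c *: x) = normc c * cnorm x;
  cnormM : forall x y : A, cnorm (x * y) <= cnorm x * cnorm y;
  cnorm_complete : forall u : nat -> A, cauchy_for cnorm u ->
    exists l : A, converges_for cnorm u l;
  starK : forall x : A, star (star x) = x;
  starD : forall x y : A, star (x + y) = star x + star y;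
  starZ : forall (c : R[i]) (x : A), star (c *: x) = c^* *: star x;
  starM : forall x y : A, star (x * y) = star y * star x;
  cnorm_starM : forall x : A, cnorm (star x * x) = cnorm x ^+ 2
}.

#[short(type="cstarAlgType")]
HB.structure Definition CStarAlgebra (R : realType) :=
  { A of isCStarAlgebra R A & GRing.Algebra R[i] A }.

Section CStar.
Context {R : realType} {A : cstarAlgType R}.
Implicit Types (a b s x : A) (f : {linear A -> R[i]^o}).

Definition cpositive b := exists x, b = star x * x.

(* The positive square root, selected by classical choice; 0 is only a dummy
   value for elements that have no positive square root. *)
Definition csqrt b : A := xget 0 [set s | cpositive s /\ s ^+ 2 = b].

Definition cmodulus a : A := csqrt (star a * a).

Definition cRe a : A := 2^-1 *: (a + star a).
Definition cIm a : A := (2 * 'i%C)^-1 *: (a - star a).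

Definition bounded_functional f :=
  exists M : R, forall x, normc (f x) <= M * cnorm x.

Definition positive_functional f := forall b, cpositive b -> 0 <= f b.

Definition dual_norm f : R :=
  sup [set normc (f x) | x in [set x | cnorm x <= 1]].

Definition state : set {linear A -> R[i]^o} :=
  [set f | [/\ bounded_functional f, positive_functional f,
               dual_norm f = 1 & f 1 = 1]].

Definition num_radius a : R := sup [set normc (f a) | f in state].

(* [f (star a * a)] is a nonnegative real for a state [f], hence equal to its
   real part. *)
Definition dw_radius a : R :=
  sup [set Num.sqrt (normc (f a) ^+ 2 + complex.Re (f (star a * a)) ^+ 2)
      | f in state].

End CStar.

(* Main.v *)
(* For a state f, positivity of f on (x + c)^* (x + c) makes f hermitian, so
   f(Re a + i a^* a) = Re f(a) + i f(a^* a), and likewise for Im a; both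
   inequalities then follow from |f(a)|^2 = (Re f(a))^2 + (Im f(a))^2 and
   |f(x)| <= ||x||.

   The substance is that a^* a has a positive square root, so that
   |a|^2 = a^* a. No spectral theory is used: a self-adjoint h is called
   near-positive when ||t - h|| <= t for some real t. Such an h has a
   near-positive square root commuting with everything h commutes with, by the
   iteration y := (x + y^2) / 2, which converges to 1 - sqrt(1 - x) whenever
   ||x|| <= 1. Squares of self-adjoint elements are near-positive, by means of
   the unitary g + i sqrt(1 - g^2). Near-positivity of a^* a =: h is Kaplansky's
   argument applied to b := a (|h| - h). *)

Require Import Defs.
From mathcomp Require Import all_boot all_order all_algebra.
From mathcomp Require Import all_classical all_reals.
From mathcomp Require Import ring lra.

Set Implicit Arguments.
Unset Strict Implicit.
Unset Printing Implicit Defensive.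

Import Order.TTheory GRing.Theory Num.Theory.

Local Open Scope classical_set_scope.
Local Open Scope ring_scope.
Local Open Scope complex_scope.

(** * Norm and involution *)

Section Norm.
Context {R : realType} {A : cstarAlgType R}.
Implicit Types (a b h s x y z : A) (r t : R).

Lemma normcR r : normc r%:C = `|r|.
Proof. by rewrite /= expr0n addr0 sqrtr_sqr. Qed.

Lemma normci : normc ('i%C : R[i]) = 1.
Proof. by rewrite /= expr0n add0r expr1n sqrtr1. Qed.

Lemma scale2R x : 2%:C *: x = x + x.
Proof. by rewrite (rmorph_nat (real_complex R) 2) scaler_nat mulr2n. Qed.

Lemma cnorm0 : cnorm (0 : A) = 0.
Proof. by rewrite -(scale0r (0 : A)) cnormZ (normcR 0) normr0 mul0r. Qed.

Lemma cnormN x : cnorm (- x) = cnorm x.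
Proof. by rewrite -scaleN1r cnormZ normcN ComplexField.Normc.normc1 mul1r. Qed.

Lemma cnorm_ge0 x : 0 <= cnorm x.
Proof. by have := cnormD x (- x); rewrite subrr cnorm0 cnormN; lra. Qed.

Lemma cnormB x y : cnorm (x - y) <= cnorm x + cnorm y.
Proof. by rewrite -(cnormN y) cnormD. Qed.

Lemma cdistC x y : cnorm (x - y) = cnorm (y - x).
Proof. by rewrite -cnormN opprB. Qed.

Lemma cnormZR r x : cnorm (r%:C *: x) = `|r| * cnorm x.
Proof. by rewrite cnormZ normcR. Qed.

Lemma cnorm_scalei x : cnorm ('i%C *: x) = cnorm x.
Proof. by rewrite cnormZ normci mul1r. Qed.

Lemma star0 : star (0 : A) = 0.
Proof. by apply: (addrI (star 0)); rewrite -starD !addr0. Qed.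

Lemma starN x : star (- x) = - star x.
Proof. by apply/eqP; rewrite -addr_eq0 -starD addNr star0. Qed.

Lemma starB x y : star (x - y) = star x - star y.
Proof. by rewrite starD starN. Qed.

Lemma star1 : star (1 : A) = 1.
Proof. by have := starM (star (1 : A)) 1; rewrite mulr1 starK mulr1 => <-. Qed.

(* [starZ] speaks of the abstract [Num.conj], convertible to [conjc]. *)
Lemma starZc c x : star (c *: x) = conjc c *: star x.
Proof. exact: starZ. Qed.

Lemma starZR r x : star (r%:C *: x) = r%:C *: star x.
Proof. by rewrite starZc conjc_real. Qed.

Lemma starZi x : star ('i%C *: x) = - ('i%C *: star x).
Proof.
rewrite starZc -scaleNr; congr (_ *: _).
by apply/eqP; rewrite eq_complex /= oppr0 !eqxx.
Qed.

Lemma cnorm_star x : cnorm (star x) = cnorm x.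
Proof.
have le_star y : cnorm y <= cnorm (star y).
  have [y0|y_gt0] := leP (cnorm y) 0; first exact: le_trans y0 (cnorm_ge0 _).
  by rewrite -(ler_pM2r y_gt0) -expr2 -cnorm_starM cnormM.
by apply/eqP; rewrite eq_le le_star -{2}(starK x) le_star.
Qed.

Lemma cnorm1 : cnorm (1 : A) = 1.
Proof.
have /eqP := cnorm_starM (1 : A); rewrite star1 mulr1 expr2.
rewrite -subr_eq0 -[X in X - _]mulr1 -mulrBr mulf_eq0 => /orP[/eqP n1|].
  by have /eqP := cnorm_eq0 _ n1; rewrite oner_eq0.
by rewrite subr_eq0 => /eqP.
Qed.

Lemma cnorm_sqr_sa h : star h = h -> cnorm (h ^+ 2) = cnorm h ^+ 2.
Proof. by move=> sh; rewrite -cnorm_starM sh expr2. Qed.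

(** The C*-identity controls squares only, hence the exponents [2 ^ k]; this stands in for the
    spectral radius formula. *)
Lemma cnorm_expr_sa h k : star h = h ->
  cnorm (h ^+ (2 ^ k)) = cnorm h ^+ (2 ^ k).
Proof.
have starX n : star h = h -> star (h ^+ n) = h ^+ n.
  move=> sh; elim: n => [|n IH]; rewrite ?star1 //.
  by rewrite [in LHS]exprSr starM IH sh -exprS.
move=> sh; elim: k => [|k IH]; first by rewrite !expr1.
by rewrite expnSr !exprM cnorm_sqr_sa ?starX // IH.
Qed.

(** Carries identities to the limit: [x] is the defect of an identity for [l], and two consecutive
    errors occur because a recursion links [u n] with [u n.+1]. *)
Lemma eq0_of_cvg (u : nat -> A) l x (K : R) : converges_for cnorm u l ->
  (forall n, cnorm x <= K * (cnorm (u n - l) + cnorm (u n.+1 - l))) -> x = 0.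
Proof.
move=> cv le_x; apply: cnorm_eq0; apply/eqP; rewrite eq_le cnorm_ge0 andbT.
rewrite leNgt; apply/negP => x_gt0.
have K_gt0 : 0 < `|K| + 1 by have := normr_ge0 K; lra.
have [|N cvN] := cv (cnorm x / (`|K| + 1) / 2).
  by rewrite !divr_gt0.
have := le_x N; apply/negP; rewrite -ltNge.
have d0 := cvN _ (leqnn N); have d1 := cvN _ (leqnSn N).
have d_ge0 : 0 <= cnorm (u N - l) + cnorm (u N.+1 - l).
  by rewrite addr_ge0 ?cnorm_ge0.
have d_lt : cnorm (u N - l) + cnorm (u N.+1 - l) < cnorm x / (`|K| + 1).
  by lra.
apply: (@le_lt_trans _ _ ((`|K| + 1) * (cnorm (u N - l) + cnorm (u N.+1 - l)))).
  by rewrite ler_wpM2r //; have := ler_norm K; lra.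
by rewrite mulrC -ltr_pdivlMr.
Qed.

Lemma cnorm_lim_le (u : nat -> A) l r : converges_for cnorm u l ->
  (forall n, cnorm (u n) <= r) -> cnorm l <= r.
Proof.
move=> cv le_u; apply/ler_addgt0Pr => e e_gt0.
have [N /(_ _ (leqnn N)) cvN] := cv e e_gt0.
rewrite -[l](subKr (u N)); apply: le_trans (cnormB _ _) _.
by rewrite lerD ?le_u // ltW.
Qed.

End Norm.

(** * Square roots by iteration *)

Section SquareRoot.
Context {R : realType} {A : cstarAlgType R}.
Implicit Types (a b h s x y z : A) (r t : R).

Definition sqrt_iter x n : A := iter n (fun y => 2^-1%:C *: (x + y ^+ 2)) 0.

(** The iteration at the scalar [x = 1], a majorant for every [x] of norm at most 1. *)
Definition sqrt_iterR n : R := iter n (fun q => (1 + q ^+ 2) / 2) 0.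

Lemma sqrt_iterR_bounds n : 0 <= sqrt_iterR n <= 1.
Proof. by elim: n => [|n /=]; rewrite ?lexx ?ler01 //; nra. Qed.

Lemma sqrt_iterR_nd m n : (m <= n)%N -> sqrt_iterR m <= sqrt_iterR n.
Proof.
elim: m n => [|m IH] [|n] //= le_mn.
  by have /andP[] := sqrt_iterR_bounds n.+1.
have := IH _ le_mn; have := sqrt_iterR_bounds m; nra.
Qed.

Lemma subrXX2 (x y : A) : x ^+ 2 - y ^+ 2 = x * (x - y) + (x - y) * y.
Proof. by rewrite mulrBr mulrBl addrA subrK -!expr2. Qed.

Lemma cnorm_subrXX2 (x y : A) :
  cnorm (x ^+ 2 - y ^+ 2) <= (cnorm x + cnorm y) * cnorm (x - y).
Proof.
rewrite subrXX2 [leRHS]mulrDl; apply: le_trans (cnormD _ _) _.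
by rewrite lerD ?cnormM // mulrC ?cnormM.
Qed.

Lemma cnorm_sqrt_iter x n :
  cnorm x <= 1 -> cnorm (sqrt_iter x n) <= sqrt_iterR n.
Proof.
move=> x1; elim: n => [|n IH] /=; first by rewrite cnorm0.
rewrite cnormZR ger0_norm ?invr_ge0 // mulrC ler_pM2r ?invr_gt0 //.
apply: le_trans (cnormD _ _) _; rewrite lerD //.
by apply: le_trans (cnormM _ _) _; rewrite expr2 ler_pM ?cnorm_ge0.
Qed.

(** The estimate [cnorm_subrXX2] is an equality for the scalar iterates, so domination passes from
    each step to the next. At norm 1 the iteration need not be a contraction; the bounded monotone
    majorant supplies the Cauchy property instead. *)
Lemma cnorm_sqrt_iterB x m n : cnorm x <= 1 -> (n <= m)%N ->
  cnorm (sqrt_iter x m - sqrt_iter x n) <= sqrt_iterR m - sqrt_iterR n.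
Proof.
move=> x1; elim: n m => [|n IH] [|m] // le_nm.
- by rewrite subrr cnorm0 /= subrr.
- by rewrite !subr0 cnorm_sqrt_iter.
rewrite /= -scalerBr opprD addrACA subrr add0r.
rewrite cnormZR ger0_norm ?invr_ge0 // -mulrBl mulrC ler_pM2r ?invr_gt0 //.
rewrite [in leRHS]opprD addrACA subrr add0r subr_sqr [leRHS]mulrC.
apply: le_trans (cnorm_subrXX2 _ _) _.
by rewrite ler_pM ?addr_ge0 ?cnorm_ge0 ?lerD ?cnorm_sqrt_iter ?IH.
Qed.

Lemma sqrt_iter_cvg x : cnorm x <= 1 ->
  exists l, converges_for cnorm (sqrt_iter x) l.
Proof.
move=> x1; apply: cnorm_complete => e e_gt0.
have supQ : has_sup (range sqrt_iterR).
  split; first by exists (sqrt_iterR 0), 0%N.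
  by exists 1 => _ [n _ <-]; have /andP[] := sqrt_iterR_bounds n.
have [_ [N _ <-] ltN] := sup_adherent e_gt0 supQ.
have le_sup n : sqrt_iterR n <= sup (range sqrt_iterR).
  by apply: ub_le_sup; [case: supQ | exists n].
have main m n : (N <= n)%N -> (n <= m)%N ->
    cnorm (sqrt_iter x m - sqrt_iter x n) < e.
  move=> leNn lenm; apply: le_lt_trans (cnorm_sqrt_iterB x1 lenm) _.
  have := le_sup m; have := sqrt_iterR_nd leNn; lra.
exists N => m n leNm leNn; have [lenm|/ltnW lemn] := leqP n m.
  exact: main.
by rewrite cdistC; apply: main.
Qed.

Lemma exists_sqrt_1B x : star x = x -> cnorm x <= 1 ->
  exists y, [/\ star y = y, cnorm y <= 1, (1 - y) ^+ 2 = 1 - x &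
                forall z, GRing.comm z x -> GRing.comm z y].
Proof.
move=> sx x1; have [l cvl] := sqrt_iter_cvg x1; set u := sqrt_iter x in cvl.
have u1 n : cnorm (u n) <= 1.
  apply: le_trans (cnorm_sqrt_iter n x1) _.
  by have /andP[] := sqrt_iterR_bounds n.
have l1 := cnorm_lim_le cvl u1.
have su n : star (u n) = u n.
  elim: n => [|n IH]; first exact: star0.
  by rewrite [u n.+1]/= starZR starD sx expr2 starM IH.
exists l; split => // [||z zx].
- apply/eqP; rewrite -subr_eq0; apply/eqP.
  apply: (eq0_of_cvg (K := 2) cvl) => n.
  rewrite -[star l](subrK (star (u n))) -starB su -addrA.
  apply: le_trans (cnormD _ _) _; rewrite cnorm_star cdistC.
  by have := cnorm_ge0 (u n.+1 - l); lra.
(* The fixed-point equation [2 l = x + l^2] is a rearrangement of [(1 - l)^2 = 1 - x]. *)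
- suff: 2%:C *: l - x - l ^+ 2 = 0.
    move/eqP; rewrite -addrA -opprD subr_eq0 => /eqP l2.
    rewrite expr2 mulrBl mul1r mulrBr mulr1 opprB -expr2.
    have -> : l ^+ 2 = l + l - x by rewrite -scale2R l2 addrC addKr.
    by rewrite (addrAC _ (- x)) addrK addrA subrK.
  (* The recursion [2 u_(n+1) = x + u_n^2] eliminates [x]; on the unit ball the squares of [u n] and
     [l] differ by at most twice their distance, whence [K = 2]. *)
  apply: (eq0_of_cvg (K := 2) cvl) => n.
  have -> : 2%:C *: l - x - l ^+ 2 =
      2%:C *: (l - u n.+1) + (u n ^+ 2 - l ^+ 2).
    rewrite scalerBr /= scalerA -rmorphM mulfV ?pnatr_eq0 // scale1r opprD.
    by rewrite !addrA subrK.
  apply: le_trans (cnormD _ _) _; rewrite cnormZR ger0_norm // cdistC.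
  have := cnorm_subrXX2 (u n) l; have := u1 n.
  have := cnorm_ge0 (u n - l); nra.
- have zu n : GRing.comm z (u n).
    elim: n => [|n IH]; first exact: commr0.
    rewrite /GRing.comm [u n.+1]/= -scalerAl -scalerAr; congr (_ *: _).
    by apply: commrD => //; apply: commrX.
  apply/eqP; rewrite -subr_eq0; apply/eqP.
  apply: (eq0_of_cvg (K := 2 * cnorm z) cvl) => n.
  have -> : z * l - l * z = (u n - l) * z - z * (u n - l).
    by rewrite mulrBl mulrBr zu opprB [RHS]addrC addrA subrK.
  apply: le_trans (cnormB _ _) _.
  have := cnormM z (u n - l); have := cnormM (u n - l) z.
  have := cnorm_ge0 (u n.+1 - l); have := cnorm_ge0 z; nra.
Qed.

End SquareRoot.

(** * Near-positive elements *)

(** If [c = (1 + d) t] with [d > 0], then [(1 + d)^(2n)] is bounded linearly in [n = 2^k], while the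
    square of Bernoulli's inequality at [n] makes it grow quadratically. *)
Lemma le_of_expr_le (R : realType) (c t M : R) : 0 < t ->
  (forall k, c ^+ (2 ^ k) <= t ^+ (2 ^ k) * (1 + (2 ^ k)%:R * M)) -> c <= t.
Proof.
move=> t_gt0 le_c; rewrite leNgt; apply/negP => lt_tc.
pose d := c / t - 1.
have d_gt0 : 0 < d by rewrite subr_gt0 ltr_pdivlMr ?mul1r.
have le_q k : (1 + d) ^+ (2 ^ k) <= 1 + (2 ^ k)%:R * M.
  by rewrite addrC subrK expr_div_n ler_pdivrMr ?exprn_gt0 // mulrC.
have bernoulli n : 1 + n%:R * d <= (1 + d) ^+ n.
  elim: n => [|n IH]; first by rewrite expr0 mul0r addr0.
  rewrite exprSr -natr1.
  have : 0 <= n%:R * d by rewrite mulr_ge0 // ltW.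
  nra.
have X_ge0 : 0 <= (1 + `|2 * M|) / d ^+ 2.
  by rewrite divr_ge0 ?sqr_ge0 // addr_ge0.
(* With [n d^2 > 1 + |2M|], the term [(n d)^2] alone outweighs the linear term [2 n M]. *)
have [k lt_k] : exists k, (1 + `|2 * M|) / d ^+ 2 < (2 ^ k)%:R.
  exists (Num.bound ((1 + `|2 * M|) / d ^+ 2)).
  by apply: lt_trans (archi_boundP X_ge0) _; rewrite ltr_nat ltn_expl.
have n_ge1 : 1 <= (2 ^ k)%:R :> R by rewrite ler1n expn_gt0.
have := le_q k.+1; rewrite expnSr exprM natrM; have := bernoulli (2 ^ k)%N.
move: lt_k n_ge1; rewrite ltr_pdivrMr ?exprn_gt0 //.
set n := (2 ^ k)%:R; set q := (1 + d) ^+ _ => lt_nd n_ge1 le_nd le_q2.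
have : n * (1 + `|2 * M|) <= (n * d) ^+ 2.
  by rewrite exprMn [n ^+ 2]expr2 -mulrA ler_pM2l ?ltW //; lra.
have : n * (2 * M) <= n * `|2 * M| by rewrite ler_pM2l ?ler_norm //; lra.
have : (1 + n * d) ^+ 2 <= q ^+ 2 by rewrite lerXn2r // nnegrE; nra.
nra.
Qed.

Section PositiveCone.
Context {R : realType} {A : cstarAlgType R}.
Implicit Types (a b h s x y z : A) (r t : R).

(** The bound confines the spectrum of [h] to [[0, 2t]]: this is ordinary positivity, in a form
    whose additivity is the triangle inequality. *)
Definition near_positive h :=
  star h = h /\ exists t, cnorm (t%:C *: 1 - h) <= t.

Lemma near_positive_gt0 h : near_positive h ->
  exists2 t, 0 < t & cnorm (t%:C *: 1 - h) <= t.
Proof.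
case=> _ [t le_t]; have := cnorm_ge0 (t%:C *: 1 - h) => ge0.
exists (1 + t); first by lra.
rewrite rmorphD scalerDl scale1r -addrA.
by apply: le_trans (cnormD _ _) _; rewrite cnorm1 lerD2l.
Qed.

Lemma near_positiveD x y :
  near_positive x -> near_positive y -> near_positive (x + y).
Proof.
case=> [sx [t le_t]] [sy [r le_r]]; split; first by rewrite starD sx sy.
exists (t + r); rewrite rmorphD scalerDl opprD addrACA.
by apply: le_trans (cnormD _ _) _; rewrite lerD.
Qed.

Lemma near_positiveZ r x : 0 <= r -> near_positive x ->
  near_positive (r%:C *: x).
Proof.
move=> r_ge0 [sx [t le_t]]; split; first by rewrite starZR sx.
exists (r * t); rewrite rmorphM -scalerA -scalerBr cnormZR ger0_norm //.
exact: ler_wpM2l.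
Qed.

(** Since [x = 1 - h / t] has norm at most 1, [h / t] has a root [1 - y]; scaled by the root of [t]
    it is near-positive because [y] has norm at most 1. *)
Lemma near_positive_sqrt h : near_positive h ->
  exists s, [/\ near_positive s, s ^+ 2 = h &
                forall z, GRing.comm z h -> GRing.comm z s].
Proof.
move=> ph; have [t t_gt0 le_t] := near_positive_gt0 ph; case: ph => sh _.
have tV : (t%:C)^-1 = t^-1%:C by rewrite fmorphV.
have [|| y [sy y1 yh yC]] := @exists_sqrt_1B R A (1 - t^-1%:C *: h).
- by rewrite starB star1 starZR sh.
- have -> : 1 - t^-1%:C *: h = t^-1%:C *: (t%:C *: 1 - h).
    by rewrite scalerBr scalerA -rmorphM mulVf ?gt_eqF // scale1r.
  by rewrite cnormZR gtr0_norm ?invr_gt0 // mulrC ler_pdivrMr ?mul1r.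
pose w := Num.sqrt t.
have w2 : w * w = t by rewrite -expr2 sqr_sqrtr // ltW.
exists (w%:C *: (1 - y)); split.
- split; first by rewrite starZR starB star1 sy.
  exists w; rewrite -scalerBr subKr cnormZR ger0_norm ?sqrtr_ge0 //.
  by rewrite ler_piMr ?sqrtr_ge0.
- rewrite exprZn yh subKr scalerA expr2 -!rmorphM w2 mulfV ?gt_eqF //.
  by rewrite scale1r.
- move=> z zh; rewrite /GRing.comm -scalerAr -scalerAl; congr (_ *: _).
  apply: commrB; first exact: commr1.
  apply: yC; apply: commrB; first exact: commr1.
  by rewrite /GRing.comm -scalerAr -scalerAl zh.
Qed.

Lemma mul_cartesian x y : (x - 'i%C *: y) * (x + 'i%C *: y) =
  x ^+ 2 + y ^+ 2 + 'i%C *: (x * y - y * x).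
Proof.
have ii : 'i%C * 'i%C = -1 :> R[i] by rewrite -expr2 sqr_i.
rewrite mulrBl !mulrDr -!scalerAl -!scalerAr scalerA ii scaleN1r scalerBr.
rewrite opprD opprK !expr2 -!addrA; congr (_ + _).
by rewrite addrC -addrA addrC -addrA.
Qed.

(** Scale [h] to [g] in the unit ball. The root [k] of [1 - g^2] is the imaginary part of the
    unitary [g + i k], so it has norm at most 1, and so has [1 - g^2 = k^2]. *)
Lemma near_positive_sqr h : star h = h -> near_positive (h ^+ 2).
Proof.
move=> sh; pose r := cnorm h + 1.
have r_gt0 : 0 < r by rewrite ltr_wpDl ?cnorm_ge0.
pose g := r^-1%:C *: h.
have sg : star g = g by rewrite starZR sh.
have g1 : cnorm g <= 1.
  rewrite cnormZR gtr0_norm ?invr_gt0 // mulrC ler_pdivrMr // mul1r.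
  by rewrite lerDl.
have -> : h ^+ 2 = (r ^+ 2)%:C *: g ^+ 2.
  rewrite exprZn scalerA -rmorphXn -rmorphM exprVn mulfV ?scale1r //.
  by rewrite expf_neq0 ?gt_eqF.
apply: near_positiveZ; first by rewrite sqr_ge0.
split; first by rewrite expr2 starM sg.
exists 1; rewrite scale1r.
have [|| y [sy y1 yg yC]] := @exists_sqrt_1B R A (g ^+ 2).
- by rewrite expr2 starM sg.
- by rewrite cnorm_sqr_sa // expr_le1 ?cnorm_ge0.
pose k := 1 - y; rewrite -yg -/k.
have sk : star k = k by rewrite starB star1 sy.
have gk : g * k = k * g.
  by apply: commrB; [exact: commr1|apply: yC; exact: commrX].
pose u := g + 'i%C *: k.
have su : star u = g - 'i%C *: k by rewrite starD starZi sg sk.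
have u1 : cnorm u = 1.
  have : cnorm u ^+ 2 = 1.
    rewrite -cnorm_starM su mul_cartesian gk subrr scaler0 addr0 yg.
    by rewrite addrC subrK cnorm1.
  by move/eqP; rewrite sqrf_eq1 => /orP[/eqP //|/eqP]; have := cnorm_ge0 u; lra.
have k1 : cnorm k <= 1.
  have : cnorm (2%:C *: ('i%C *: k)) <= 2.
    have -> : 2%:C *: ('i%C *: k) = u - star u.
      rewrite su opprB addrC [in RHS]addrA subrK.
      by rewrite scale2R.
    by apply: le_trans (cnormB _ _) _; rewrite cnorm_star u1.
  by rewrite cnormZR cnorm_scalei ger0_norm //; lra.
by rewrite cnorm_sqr_sa // expr_le1 ?cnorm_ge0.
Qed.

Lemma star_mul_eq0 x : star x * x = 0 -> x = 0.
Proof.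
move=> xx; apply: cnorm_eq0; have := cnorm_starM x; rewrite xx cnorm0.
by move/esym/eqP; rewrite sqrf_eq0 => /eqP.
Qed.

(** Commutation turns the sum into [star u * u] with [u = x + i y]; then [u = 0], and so is its real
    part [x]. *)
Lemma comm_sqr_sum_eq0 x y : star x = x -> star y = y -> GRing.comm x y ->
  x ^+ 2 + y ^+ 2 = 0 -> x = 0.
Proof.
move=> sx sy xy xy0; have u0 : x + 'i%C *: y = 0.
  apply: star_mul_eq0.
  by rewrite starD starZi sx sy mul_cartesian xy0 xy subrr scaler0 addr0.
apply: cnorm_eq0.
have := congr1 star u0; rewrite starD starZi sx sy star0 => v0.
have : 2%:C *: x = 0.
  rewrite scale2R.
  have <- : (x + 'i%C *: y) + (x - 'i%C *: y) = x + x.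
    by rewrite addrACA subrr addr0.
  by rewrite u0 v0 addr0.
by move/(congr1 cnorm); rewrite cnormZR cnorm0 ger0_norm //; lra.
Qed.

(* Spectra are avoided: [(t - b^* b)^N] differs from [t^N] by
   [b^* r b], where [r] is a polynomial in [b b^*] whose norm grows only
   like [N t^N], and [cnorm] is multiplicative on powers [2^k]. *)
Lemma near_positive_mulC b : near_positive (b * star b) ->
  near_positive (star b * b).
Proof.
move=> pb; have [t t_gt0 le_t] := near_positive_gt0 pb.
split; first by rewrite starM starK.
exists t; set T := t%:C *: 1 : A.
have expand N : exists2 r, t * cnorm r <= N%:R * t ^+ N &
    (T - star b * b) ^+ N = (t ^+ N)%:C *: 1 - star b * r * b.
  elim: N => [|N [r le_r IH]].
    exists 0; first by rewrite cnorm0 mulr0 mul0r.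
    by rewrite !expr0 scale1r mulr0 mul0r subr0.
  (* Moving [b] past [T - star b * b] turns that factor into [T - b * star b], which dictates this
     recursion; the norm bound gains one term [t ^+ N.+1]. *)
  exists ((t ^+ N)%:C *: 1 + r * (T - b * star b)).
    have := cnormD ((t ^+ N)%:C *: 1) (r * (T - b * star b)).
    rewrite cnormZR cnorm1 mulr1 ger0_norm ?exprn_ge0 ?(ltW t_gt0) // => le_s.
    have le_m : cnorm (r * (T - b * star b)) <= cnorm r * t.
      by apply: le_trans (cnormM _ _) _; rewrite ler_wpM2l ?cnorm_ge0.
    rewrite -natr1 exprS mulrDl mul1r.
    apply: (@le_trans _ _ (t * (t ^+ N + cnorm r * t))).
      by rewrite ler_pM2l //; lra.
    by have := ler_wpM2l (ltW t_gt0) le_r; lra.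
  have bT : b * (T - star b * b) = (T - b * star b) * b.
    by rewrite mulrBr mulrBl mulrA /T -scalerAr -scalerAl mulr1 mul1r.
  rewrite exprSr IH mulrBl -(mulrA (star b * r)) bT [in LHS]mulrBr.
  rewrite /T -!scalerAl !mul1r scalerA -rmorphM -exprSr -/T.
  rewrite mulrDr mulrDl -scalerAr mulr1 -scalerAl opprD.
  by rewrite !mulrA addrA.
have Tsa : star (T - star b * b) = T - star b * b.
  by rewrite starB /T starZR star1 starM starK.
(* The constant combines [cnorm (star b * r * b) <= cnorm b ^+ 2 * cnorm r] with the bound on
   [t * cnorm r]. *)
apply: (@le_of_expr_le _ _ _ (cnorm b ^+ 2 / t)) => // k.
rewrite -cnorm_expr_sa //; have [r le_r ->] := expand (2 ^ k)%N.
apply: le_trans (cnormB _ _) _.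
rewrite cnormZR cnorm1 mulr1 ger0_norm ?exprn_ge0 ?(ltW t_gt0) //.
rewrite mulrDr mulr1 lerD2l.
have le_m : cnorm (star b * r * b) <= cnorm b ^+ 2 * cnorm r.
  apply: le_trans (cnormM _ _) _; rewrite expr2 mulrAC.
  rewrite ler_wpM2r ?cnorm_ge0 //.
  by apply: le_trans (cnormM _ _) _; rewrite cnorm_star.
apply: le_trans le_m _.
rewrite -(ler_pM2l t_gt0).
have -> : t * (t ^+ (2 ^ k) * ((2 ^ k)%:R * (cnorm b ^+ 2 / t))) =
  cnorm b ^+ 2 * ((2 ^ k)%:R * t ^+ (2 ^ k)) by field; rewrite gt_eqF.
by rewrite mulrCA ler_wpM2l ?sqr_ge0.
Qed.

Lemma near_positive_star_mul a : near_positive (star a * a).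
Proof.
set h := star a * a.
have sh : star h = h by rewrite starM starK.
(* Here [m] is [|h|], [q] is its root, and [n] is twice the negative part of [h], to be shown
   zero. *)
have [m [pm mm mC]] := near_positive_sqrt (near_positive_sqr sh).
have [q [pq qq qC]] := near_positive_sqrt pm.
have [[sm _] [sq _]] := (pm, pq).
have hm : h * m = m * h by apply: mC; apply: commrX.
pose n := m - h.
have sn : star n = n by rewrite starB sm sh.
have mn : m * n = n * m by rewrite mulrBr mulrBl hm.
have qn : n * q = q * n by apply: qC.
have hn : h * n = - (m * n) by rewrite !mulrBr hm -expr2 -mm opprB expr2.
have sqn : star (q * n) = q * n by rewrite starM sq sn.
pose b := a * n.
(* [star b * b = n h n = - n m n], and [m = q^2] with [q] commuting with [n]. *)
have bb : star b * b = - (q * n) ^+ 2.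
  rewrite starM sn mulrA -(mulrA n) -/h -mulrA hn mulrN; congr (- _).
  rewrite -qq !expr2 -!mulrA !(mulrA n) qn -!mulrA.
  by rewrite [n * (q * _)]mulrA qn !mulrA.
have pbb : near_positive (b * star b).
  (* Up to sign these are twice the Cartesian parts of [b], so [x^2 + y^2] is twice
     [b * star b + star b * b]; as [star b * b] is minus a square, [b * star b] becomes a positive
     combination of squares. *)
  pose x := b + star b; pose y := 'i%C *: (b - star b).
  have sx : star x = x by rewrite starD starK addrC.
  have sy : star y = y by rewrite starZi starB starK -scalerN opprB.
  have -> : b * star b = 2^-1%:C *: (x ^+ 2 + y ^+ 2) + (q * n) ^+ 2.
    have -> : x ^+ 2 + y ^+ 2 = 2%:C *: (b * star b - (q * n) ^+ 2).
      rewrite exprZn sqr_i scaleN1r subrXX2 -bb.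
      have -> : x - (b - star b) = 2%:C *: star b.
        by rewrite opprB addrC [LHS]addrA subrK scale2R.
      rewrite -scalerAl -scalerAr -scalerDr mulrDl mulrBr.
      by rewrite -addrA [_ * _ + (_ - _)]addrC subrK.
    by rewrite scalerA -rmorphM mulVf ?pnatr_eq0 // scale1r subrK.
  apply: near_positiveD; last exact: near_positive_sqr.
  apply: near_positiveZ; first by rewrite invr_ge0.
  by apply: near_positiveD; apply: near_positive_sqr.
(* Now [star b * b] is both [s ^+ 2] and [- (q * n) ^+ 2]: squares of two commuting self-adjoint
   elements sum to 0. *)
have [s [[ss _] s2 sC]] := near_positive_sqrt (near_positive_mulC pbb).
have qn0 : q * n = 0.
  apply: (@comm_sqr_sum_eq0 _ s) => //.
    by apply: sC; rewrite bb; apply: commrN; apply: commrX.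
  by rewrite s2 bb subrr.
have n0 : n = 0.
  have mn0 : m * n = 0 by rewrite -qq expr2 -mulrA qn0 mulr0.
  by apply: star_mul_eq0; rewrite sn {1}/n mulrBl mn0 hn mn0 oppr0 subr0.
by move/eqP: n0; rewrite subr_eq0 => /eqP <-.
Qed.

(** Roots are taken twice: the root [s] of [star a * a] is itself [r ^+ 2 = star r * r], hence
    [cpositive], so [xget] selects from a nonempty set. *)
Lemma cmodulus_sqr a : cmodulus a ^+ 2 = star a * a.
Proof.
rewrite /cmodulus /csqrt; case: xgetP => [_ -> [] // | ].
have [s [ps s2 _]] := near_positive_sqrt (near_positive_star_mul a).
have [r [[sr _] r2 _]] := near_positive_sqrt ps.
by move=> /(_ s)[]; split => //; exists r; rewrite sr -r2 expr2.
Qed.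

End PositiveCone.

(** * States *)

Section States.
Context {R : realType} {A : cstarAlgType R}.
Implicit Types (a b c x : A) (f : {linear A -> R[i]^o}).

Lemma normc_sqr (z : R[i]) :
  normc z ^+ 2 = complex.Re z ^+ 2 + complex.Im z ^+ 2.
Proof. by case: z => u v /=; rewrite sqr_sqrtr // addr_ge0 ?sqr_ge0. Qed.

Lemma normc_ge0 (z : R[i]) : 0 <= normc z.
Proof. by case: z => u v /=; rewrite sqrtr_ge0. Qed.

Lemma state_norm_le f x : state f -> normc (f x) <= cnorm x.
Proof.
move=> [[M le_M] _ f1 _].
have [/cnorm_eq0 ->|x_neq0] := eqVneq (cnorm x) 0.
  by rewrite linear0 ComplexField.Normc.normc0 cnorm0.
have x_gt0 : 0 < cnorm x by rewrite lt0r x_neq0 cnorm_ge0.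
pose y := (cnorm x)^-1%:C *: x.
have y1 : cnorm y = 1.
  by rewrite cnormZR gtr0_norm ?invr_gt0 // mulVf.
have: normc (f y) <= 1.
  rewrite -f1; apply: ub_le_sup; last by exists y; rewrite //= y1.
  exists `|M| => _ [z /= z1 <-]; apply: le_trans (le_M z) _.
  apply: le_trans (ler_wpM2r (cnorm_ge0 _) (ler_norm M)) _.
  by rewrite ler_piMr.
rewrite linearZ ComplexField.Normc.normcM normcR gtr0_norm ?invr_gt0 //.
by rewrite mulrC ler_pdivrMr // mul1r.
Qed.

Lemma state_star_mul_real f x : state f -> complex.Im (f (star x * x)) = 0.
Proof.
case=> _ /(_ (star x * x)) pf _ _.
have : 0 <= f (star x * x) by apply: pf; exists x.
by rewrite lecE => /andP[/eqP].
Qed.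

Lemma state_star f x : state f -> f (star x) = conjc (f x).
Proof.
move=> sf; have [_ _ _ f1] := sf.
have r0 := state_star_mul_real x sf.
(* Adding 1 shows that [f x] and [f (star x)] have opposite imaginary parts; adding ['i] shows that
   their real parts agree. *)
have := state_star_mul_real (x + 1) sf.
have := state_star_mul_real (x + 'i%C *: 1) sf.
rewrite !starD starZi star1 !mulrDl !mulrDr mulNr mulr1 mul1r.
rewrite -!scalerAl -!scalerAr !mul1r !mulr1.
rewrite !linearD !linearN !linearZ /= ?linearN ?linearZ /= ?f1.
move: r0; case: (f (star x * x)) => p0 q0 /=.
case: (f x) => p q; case: (f (star x)) => u v.
rewrite /GRing.scale /=.
move=> q00 h1 h2; apply/eqP; rewrite eq_complex /=.
by apply/andP; split; apply/eqP; lra.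
Qed.

Lemma state_cRe f x : state f -> f (cRe x) = (complex.Re (f x))%:C.
Proof.
by move=> sf; rewrite linearZ linearD /= state_star // ReJ_add mulrC.
Qed.

Lemma state_cIm f x : state f -> f (cIm x) = (complex.Im (f x))%:C.
Proof.
move=> sf; rewrite linearZ linearB /= state_star // subcJ.
rewrite mulrAC; apply: mulKf.
by rewrite mulf_neq0 ?pnatr_eq0 // eq_complex /= oner_eq0 andbF.
Qed.

Lemma state_add_i_cmodulus f a b (p : R) : state f -> f b = p%:C ->
  normc (f (b + 'i%C *: cmodulus a ^+ 2)) ^+ 2 =
  p ^+ 2 + complex.Re (f (star a * a)) ^+ 2.
Proof.
move=> sf fb; have := state_star_mul_real a sf.
rewrite linearD linearZ /= fb cmodulus_sqr normc_sqr.
case: (f (star a * a)) => u v /= ->.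
by congr (_ ^+ 2 + _ ^+ 2); ring.
Qed.

(** Serves both halves, [c] being the Cartesian part of [a] absent from [b]. For each state,
    dropping [f c] gives the lower bound and estimating it by [cnorm c] the upper one. *)
Lemma dw_radius_bounds a b c :
  (forall f, state f -> normc (f b) ^+ 2 + normc (f c) ^+ 2 =
     normc (f a) ^+ 2 + complex.Re (f (star a * a)) ^+ 2) ->
  num_radius b <= dw_radius a /\
  dw_radius a <= Num.sqrt (num_radius b ^+ 2 + cnorm c ^+ 2).
Proof.
move=> Pyth.
(* Without states each supremum is [sup set0 = 0] and both bounds hold; otherwise [f0] witnesses the
   nonemptiness that [ge_sup] asks for. *)
have [[f0 sf0]|no_state] := pselect (exists f, state (A := A) f); last first.
  have st0 : state (A := A) = set0.
    by apply/seteqP; split => // f sf; apply: no_state; exists f.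
  by rewrite /num_radius /dw_radius st0 !image_set0 sup0 sqrtr_ge0.
have ub_b f : state f -> normc (f b) <= num_radius b.
  move=> sf; apply: ub_le_sup; last by exists f.
  by exists (cnorm b) => _ [g sg <-]; exact: state_norm_le.
have ub_a f : state f ->
    Num.sqrt (normc (f a) ^+ 2 + complex.Re (f (star a * a)) ^+ 2) <=
    dw_radius a.
  move=> sf; apply: ub_le_sup; last by exists f.
  exists (Num.sqrt (cnorm a ^+ 2 + cnorm (star a * a) ^+ 2)) => _ [g sg <-].
  rewrite ler_wsqrtr // lerD //.
    by rewrite lerXn2r ?nnegrE ?normc_ge0 ?cnorm_ge0 // state_norm_le.
  apply: (@le_trans _ _ (normc (g (star a * a)) ^+ 2)).
    by rewrite normc_sqr lerDl sqr_ge0.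
  by rewrite lerXn2r ?nnegrE ?normc_ge0 ?cnorm_ge0 // state_norm_le.
split; apply: ge_sup; try by [eexists; exists f0].
  move=> _ [f sf <-]; apply: le_trans (ub_a f sf).
  rewrite -Pyth // -[leLHS]ger0_norm ?normc_ge0 // -sqrtr_sqr ler_wsqrtr //.
  by rewrite lerDl sqr_ge0.
move=> _ [f sf <-]; rewrite -Pyth // ler_wsqrtr // lerD //.
  have := ub_b f sf; have := normc_ge0 (f b) => ge0 le_b.
  by rewrite lerXn2r ?nnegrE // (le_trans ge0).
by rewrite lerXn2r ?nnegrE ?normc_ge0 ?cnorm_ge0 // state_norm_le.
Qed.

End States.

Local Close Scope classical_set_scope.

Theorem theorem3p19 (R : realType) (A : cstarAlgType R) (a : A) :
  Num.max (num_radius (cRe a + 'i%C *: cmodulus a ^+ 2))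
          (num_radius (cIm a + 'i%C *: cmodulus a ^+ 2)) <= dw_radius a /\
  dw_radius a <=
    Num.min
      (Num.sqrt (num_radius (cRe a + 'i%C *: cmodulus a ^+ 2) ^+ 2
                 + cnorm (cIm a) ^+ 2))
      (Num.sqrt (num_radius (cIm a + 'i%C *: cmodulus a ^+ 2) ^+ 2
                 + cnorm (cRe a) ^+ 2)).
Proof.
set b := cRe a + _; set c := cIm a + _.
have [lower_Re upper_Re] : num_radius b <= dw_radius a /\
    dw_radius a <= Num.sqrt (num_radius b ^+ 2 + cnorm (cIm a) ^+ 2).
  apply: dw_radius_bounds => f sf.
  rewrite (state_add_i_cmodulus _ sf (state_cRe a sf)) state_cIm //.
  by rewrite !normc_sqr /=; ring.
have [lower_Im upper_Im] : num_radius c <= dw_radius a /\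
    dw_radius a <= Num.sqrt (num_radius c ^+ 2 + cnorm (cRe a) ^+ 2).
  apply: dw_radius_bounds => f sf.
  rewrite (state_add_i_cmodulus _ sf (state_cIm a sf)) state_cRe //.
  by rewrite !normc_sqr /=; ring.
by rewrite ge_max le_min lower_Re lower_Im upper_Re upper_Im.
Qed.
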